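(* Let $G$ be a finite, simple, undirected graph that is a $(0,2)$-graph and is three-colourable. Then $G$ is bipartite. Consequently, no finite $(0,2)$-graph has chromatic number exactly three.
   Context: All graphs are finite, simple (no loops or multiple edges) and undirected. $N(v)$ denotes the set of neighbours of a vertex $v$. A graph $G$ is a $(0,2)$-graph if for all distinct vertices $x,y$ of $G$ (adjacent or not) one has $|N(x)\cap N(y)|\in\{0,2\}$. $G$ is three-colourable if there is a map $c:V(G)\to\mathbb{Z}/3\mathbb{Z}$ with $c(x)\neq c(y)$ whenever $x$ and $y$ are adjacent (a proper three-colouring). Graphs are not assumed connected. *)

(* Defs.v *)
From mathcomp Require Import all_boot all_algebra.

Set Implicit Arguments.
Unset Strict Implicit.
Unset Printing Implicit Defensive.

Record sgraph := SGraph {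
  vertex :> finType;
  adj : rel vertex;
  adj_sym : symmetric adj;
  adj_irrefl : irreflexive adj
}.

Definition nbh (G : sgraph) (x : G) : {set G} := [set y | adj x y].

(* The condition ranges over adjacent and non-adjacent pairs alike. *)
Definition zero_two_graph (G : sgraph) : Prop :=
  forall x y : G, x != y ->
    #|nbh x :&: nbh y| = 0 \/ #|nbh x :&: nbh y| = 2.

Definition proper_colouring (G : sgraph) (C : eqType) (c : G -> C) : bool :=
  [forall x : G, forall y : G, adj x y ==> (c x != c y)].

Definition three_colourable (G : sgraph) : Prop :=
  exists c : G -> 'Z_3, proper_colouring c.

(* A and its complement are the two parts; either may be empty. *)
Definition bipartite (G : sgraph) : Prop :=
  exists A : {set G}, forall x y : G, adj x y -> (x \in A) != (y \in A).

Definition colourable (G : sgraph) (k : nat) : bool :=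
  [exists c : {ffun G -> 'I_k}, proper_colouring c].

Lemma colourable_order (G : sgraph) : exists k, colourable G k.
Proof.
exists #|G|; apply/existsP; exists [ffun x => enum_rank x].
apply/forallP=> x; apply/forallP=> y; apply/implyP=> xy.
rewrite !ffunE; apply/eqP=> /enum_rank_inj eq_xy.
by rewrite eq_xy adj_irrefl in xy.
Qed.

Definition chromatic_number (G : sgraph) : nat := ex_minn (colourable_order G).

(* Main.v *)
Require Import Defs.
From mathcomp Require Import all_boot all_algebra.
From mathcomp Require Import zify.

Set Implicit Arguments.
Unset Strict Implicit.
Unset Printing Implicit Defensive.

Import GRing.Theory.

(** A proper colouring [c] by Z/3 gives every directed edge [xy] the weight +1 or
-1, the integer representative of [c y - c x].  Around a 4-cycle the weights sum
to an even integer of absolute value at most 4 that is divisible by 3, hence to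
0.  A closed walk of odd length has odd total weight.  The point is thus to show
that in a (0,2)-graph weights that vanish on 4-cycles vanish on all closed
walks.

The reason is Mulder's bound on the diameter: in a (0,2)-graph a vertex at
distance [n] from [x] has at least [n] neighbours at distance [n - 1]
([zero_two_down_degree]), so two vertices joined by some walk are joined by one
no longer than the maximum degree ([zero_two_short_walk]).  Now pass to the
cover of [G] with vertices [(v, a)], where [a] records the weight accumulated
along a walk.  Since 4-cycles have weight 0 they lift to 4-cycles, and the cover
is again a (0,2)-graph ([cover_zero_two]), with the same degrees as [G].  A
closed walk at [x] of nonzero weight, lifted and repeated, would join [(x, 0)]
to points of the cover over [x] whose weight is arbitrarily large; but weight
changes by 1 per step, so such points are too far away.

To stay within finite graphs, weights are taken modulo [2M] with [M] greater
than all degrees.  The modulus is even so that parity survives: [M] repetitions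
of a closed walk of odd weight lead exactly to weight [M], the residue furthest
from 0, which is reached in no fewer than [M] steps
([three_coloured_no_odd_closed_walk]).

A graph of chromatic number three is three-colourable, hence bipartite, hence
two-colourable, which is absurd. *)

(** * Walks *)

Fixpoint walk (G : sgraph) (n : nat) (x y : G) : bool :=
  if n is m.+1 then [exists z : G, walk m x z && adj z y] else x == y.

Lemma walkS (G : sgraph) n (x y z : G) :
  walk n x z -> adj z y -> walk n.+1 x y.
Proof. by move=> wxz zy; apply/existsP; exists z; apply/andP. Qed.

Lemma walkSE (G : sgraph) n (x y : G) :
  walk n.+1 x y -> exists2 z, walk n x z & adj z y.
Proof. by case/existsP=> z /andP[]; exists z. Qed.

Lemma walk_cat (G : sgraph) m n (x y z : G) :
  walk m x y -> walk n y z -> walk (m + n) x z.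
Proof.
move=> wxy; elim: n z => [|n IHn] z; first by move/eqP <-; rewrite addn0.
by case/walkSE=> t wyt tz; rewrite addnS; apply: walkS tz; apply: IHn.
Qed.

Lemma walk_edge (G : sgraph) (x y : G) : adj x y -> walk 1 x y.
Proof. by apply: walkS => /=. Qed.

Lemma walk_rev (G : sgraph) n (x y : G) : walk n x y -> walk n y x.
Proof.
elim: n y => [|n IHn] y; first by rewrite /= eq_sym.
case/walkSE=> z wxz zy; rewrite -add1n.
by apply: walk_cat (IHn _ wxz); apply: walk_edge; rewrite adj_sym.
Qed.

Lemma connect_walk (G : sgraph) (x y : G) :
  connect (@adj G) x y -> exists n, walk n x y.
Proof.
case/connectP=> p; elim/last_ind: p y => [|p z IHp] y.
  by move=> _ /= ->; exists 0 => /=.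
rewrite rcons_path last_rcons => /andP[xp lz] ->.
by have [n wn] := IHp _ xp erefl; exists n.+1; apply: walkS lz.
Qed.

(** In each component, the parts are given by the parity of a chosen walk from a
root; an edge between equal parities would close an odd walk through the root. *)
Lemma bipartite_no_odd_closed_walk (G : sgraph) :
  (forall n (x : G), walk n x x -> ~~ odd n) -> bipartite G.
Proof.
move=> evenG; pose r (x : G) := fingraph.root (@adj G) x.
have csym : connect_sym (@adj G) by apply/sym_connect_sym/adj_sym.
have ex_len x : exists n, walk n (r x) x.
  by apply: connect_walk; rewrite csym connect_root.
pose len x := ex_minn (ex_len x).
have lenP x : walk (len x) (r x) x by rewrite /len; case: ex_minnP.
exists [set x | odd (len x)] => x y xy; rewrite !inE.
have rxy : r x = r y by apply/(fingraph.rootP csym)/connect1.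
have := walk_cat (walkS (lenP x) xy) (walk_rev (lenP y)).
by rewrite -rxy => /evenG; rewrite oddD /=; do 2!case: odd.
Qed.

(** * Distances in (0,2)-graphs *)

Definition at_dist (G : sgraph) (x : G) n (y : G) : bool :=
  walk n x y && [forall m : 'I_n, ~~ walk m x y].

Lemma at_distP (G : sgraph) (x : G) n y :
  reflect (walk n x y /\ forall m, walk m x y -> n <= m) (at_dist x n y).
Proof.
apply: (iffP andP) => [[wn minn]|[wn minn]]; split=> //.
  move=> m wm; case: leqP => // mn.
  by have /forallP/(_ (Ordinal mn)) := minn; rewrite wm.
by apply/forallP=> m; apply/negP=> /minn; rewrite leqNgt ltn_ord.
Qed.

Lemma at_dist_pred (G : sgraph) (x : G) n y :
  at_dist x n.+1 y -> exists2 p, at_dist x n p & adj p y.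
Proof.
case/at_distP=> /walkSE[p wp py] miny; exists p => //.
by apply/at_distP; split=> // m /walkS/(_ py)/miny.
Qed.

Lemma zero_two_other_common (G : sgraph) (x y p : G) :
  zero_two_graph G -> x != y -> adj x p -> adj y p ->
  exists w, [/\ w != p, adj x w & adj y w].
Proof.
move=> G02 xy xp yp; have pI : p \in nbh x :&: nbh y by rewrite !inE xp.
case: (G02 x y xy) => [/cards0_eq I0|]; first by rewrite I0 inE in pI.
rewrite (cardsD1 p) pI => -[/eqP/cards1P[w Iw]]; exists w.
by have := set11 w; rewrite -Iw !inE => /and3P[-> -> ->].
Qed.

Lemma zero_two_common_le2 (G : sgraph) (p w y z t : G) :
  zero_two_graph G -> p != w ->
  {subset [:: y; z; t] <= nbh p :&: nbh w} -> y != z -> y != t -> z = t.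
Proof.
move=> G02 pw sub yz yt; apply/eqP/negPn/negP=> zt.
have : #|[set y; z; t]| <= #|nbh p :&: nbh w|.
  apply/subset_leq_card/subsetP=> u; rewrite !inE => uyzt.
  by have := sub u; rewrite !inE orbA; apply.
rewrite setUC cardsU1 cards2 !inE yz eq_sym (negPf yt) eq_sym (negPf zt) /=.
by case: (G02 p w pw) => ->.
Qed.

(** Let [p] be a neighbour of [y] one level closer to [x].  Each neighbour [z] of
[p] one level below [p] has exactly one common neighbour [w] with [y] besides
[p], and [w] lies on the level of [p].  The map from [z] to [w] is injective,
since [p] and [w] already share [y] and can share only one more vertex.  So [y]
has one more lower neighbour than [p], namely [p] itself. *)
Lemma zero_two_down_degree (G : sgraph) (x : G) n y :
  zero_two_graph G -> at_dist x n.+1 y ->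
  n < #|[set p in nbh y | at_dist x n p]|.
Proof.
move=> G02; elim: n y => [|n IHn] y dy; have [p dp py] := at_dist_pred dy.
  by apply/card_gt0P; exists p; rewrite !inE adj_sym py.
have /at_distP[_ miny] := dy.
set D := [set q in nbh y | _]; set E := [set z in nbh p | at_dist x n z].
have pD : p \in D by rewrite !inE adj_sym py.
have E_P z : z \in E -> [/\ adj p z, walk n x z & z != y].
  rewrite !inE => /andP[pz /at_distP[wz _]]; split=> //.
  by apply: contraTneq wz => ->; apply/negP=> /miny; rewrite ltnNge leqnSn.
(* The default [p] is never taken: for [z] in [E] the vertex exists. *)
pose f z := odflt p [pick w | [&& w != p, adj y w & adj z w]].
have fP z : z \in E -> [/\ f z != p, adj y (f z) & adj z (f z)].
  case/E_P=> pz _ zy; rewrite /f; case: pickP => [w /and3P[] //|no].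
  have [|||w [wp' yw zw]] := @zero_two_other_common _ y z p G02.
  - by rewrite eq_sym.
  - by rewrite adj_sym.
  - by rewrite adj_sym.
  by have := no w; rewrite wp' yw zw.
have f_inj : {in E &, injective f}.
  move=> z t zE tE eqf; have [fp yf zf] := fP z zE; have [_ _ tf] := fP t tE.
  have [pz _ zy] := E_P z zE; have [pt _ ty] := E_P t tE.
  apply: (zero_two_common_le2 (y := y) (p := p) (w := f z) G02).
  - by rewrite eq_sym.
  - move=> u; rewrite !inE => /or3P[] /eqP->.
    + by rewrite py adj_sym.
    + by rewrite pz adj_sym.
    + by rewrite pt adj_sym eqf.
  - by rewrite eq_sym.
  - by rewrite eq_sym.
apply: leq_ltn_trans (IHn p dp) _; rewrite -/E (cardsD1 p D) pD ltnS.
rewrite -(card_in_imset f_inj); apply/subset_leq_card/subsetP.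
move=> _ /imsetP[z zE ->]; have [fp yf zf] := fP z zE.
have [_ wz _] := E_P z zE; rewrite !inE fp yf; apply/at_distP; split.
  exact: walkS zf.
by move=> m wm; rewrite -ltnS; apply: miny; apply: walkS wm _; rewrite adj_sym.
Qed.

Lemma zero_two_short_walk (G : sgraph) K n (x y : G) :
  zero_two_graph G -> (forall v : G, #|nbh v| <= K) -> walk n x y ->
  exists2 m, m <= K & walk m x y.
Proof.
move=> G02 degK wn; have ex_n : exists n, walk n x y by exists n.
case: (ex_minnP ex_n) => m wm minm; exists m => //.
case: m => // m in wm minm *; apply: leq_trans (degK y).
have dy : at_dist x m.+1 y by apply/at_distP.
apply: leq_trans (zero_two_down_degree G02 dy) _.
by apply/subset_leq_card/subsetP=> p; rewrite inE => /andP[].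
Qed.

Local Open Scope ring_scope.

(** * Covers derived from edge weights *)

(** This is the derived graph of a voltage assignment [s] with values in [Z]: the
second component of a vertex is the weight accumulated along a walk. *)
Section Cover.

Variables (G : sgraph) (Z : finZmodType) (s : G -> G -> Z).

Hypothesis s_anti : forall x y : G, adj x y -> s y x = - s x y.

Definition cover_adj (u v : G * Z) : bool :=
  adj u.1 v.1 && (v.2 == u.2 + s u.1 v.1).

Lemma cover_sym : symmetric cover_adj.
Proof.
move=> [x a] [y b]; rewrite /cover_adj /= adj_sym.
case yx: (adj y x) => //=; rewrite (s_anti yx).
by rewrite eq_sym -subr_eq.
Qed.

Lemma cover_irrefl : irreflexive cover_adj.
Proof. by case=> x a; rewrite /cover_adj /= adj_irrefl. Qed.

Definition cover : sgraph := SGraph cover_sym cover_irrefl.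

Lemma cover_nbh x a :
  nbh ((x, a) : cover) = [set (w, a + s x w) | w in nbh x].
Proof.
apply/setP=> -[w e]; rewrite inE /= /cover_adj /=.
apply/andP/imsetP=> [[xw /eqP->]|[t xt [-> ->]]]; last first.
  by rewrite inE in xt.
by exists w => //; rewrite inE.
Qed.

Lemma cover_degree (u : cover) : (#|nbh u| <= #|G|)%N.
Proof.
case: u => x a; rewrite cover_nbh.
exact: leq_trans (leq_imset_card _ _) (max_card _).
Qed.

Lemma cover_lift n (x y : G) a :
  walk n x y -> exists b, walk n ((x, a) : cover) (y, b).
Proof.
elim: n y => [|n IHn] y; first by move/eqP <-; exists a => /=.
case/walkSE=> z /IHn[b wb] zy; exists (b + s z y).
by apply: walkS wb _; rewrite /= /cover_adj /= zy eqxx.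
Qed.

Lemma cover_translate n (x y : G) a b t :
  walk n ((x, a) : cover) (y, b) -> walk n ((x, a + t) : cover) (y, b + t).
Proof.
elim: n y b => [|n IHn] y b; first by case/eqP=> -> -> /=.
case/walkSE=> -[z e] /IHn we /andP[/= zy /eqP ->].
by apply: walkS we _; rewrite /= /cover_adj /= zy addrAC eqxx.
Qed.

Lemma cover_repeat n k (x : G) a :
  walk n ((x, 0) : cover) (x, a) ->
  walk (k * n) ((x, 0) : cover) (x, a *+ k).
Proof.
move=> wa; elim: k => [|k IHk]; first by rewrite mulr0n /=.
rewrite mulrS mulSn; apply: walk_cat wa _.
by have := cover_translate a IHk; rewrite add0r addrC.
Qed.

Hypothesis s_flat : forall x y z t : G,
  adj x y -> adj y z -> adj x t -> adj t z -> s x y + s y z = s x t + s t z.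

(** Vertices [(x, a)] and [(y, b)] of the cover with a common neighbour [(w, e)]
lie over distinct vertices.  By flatness on the 4-cycle [x w y t], every common
neighbour [t] of [x] and [y] then lifts to exactly one common neighbour of the
two. *)
Lemma cover_zero_two : zero_two_graph G -> zero_two_graph cover.
Proof.
move=> G02 [x a] [y b] neq.
have [->|[[w e]]] := set_0Vmem (nbh ((x, a) : cover) :&: nbh ((y, b) : cover)).
  by left; rewrite cards0.
rewrite !inE /= /cover_adj /= => /andP[/andP[xw /eqP ea] /andP[yw /eqP eb]].
have xy : x != y.
  apply: contraNneq neq => xy; rewrite xy in ea *.
  by rewrite xpair_eqE eqxx /=; apply/eqP/(addIr (s y w)); rewrite -ea.
suff -> : nbh ((x, a) : cover) :&: nbh ((y, b) : cover)
          = [set (t, a + s x t) | t in nbh x :&: nbh y].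
  by rewrite card_imset; [apply: G02 | move=> t1 t2 []].
apply/setP=> -[t f]; rewrite !inE /= /cover_adj /=.
apply/andP/imsetP=> [[/andP[xt /eqP->] /andP[yt _]]|[u uI [-> ->]]].
  by exists t; rewrite // !inE xt.
move: uI; rewrite !inE => /andP[xu yu]; rewrite xu yu eqxx; split=> //=.
have uy : adj u y by rewrite adj_sym.
have wy : adj w y by rewrite adj_sym.
have su := s_flat xu uy xw wy; rewrite (s_anti yu) (s_anti yw) in su.
by rewrite -subr_eq -addrA su addrA -ea eb addrK.
Qed.

End Cover.

(** * Weights coming from a three-colouring *)

Section Weight.

Variables (R : pzRingType) (G : sgraph) (c : G -> 'Z_3).

Definition weight (x y : G) : R := if c y == c x + 1 then 1 else -1.

Hypothesis c_proper : proper_colouring c.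

Lemma colour_neq (x y : G) : adj x y -> c x != c y.
Proof. by have /forallP/(_ x)/forallP/(_ y)/implyP := c_proper. Qed.

Lemma weight_anti (x y : G) : adj x y -> weight y x = - weight x y.
Proof.
move/colour_neq; rewrite /weight; move: (c x) (c y).
by do 2!case=> [[|[|[|//]]] ?] //=; rewrite ?opprK.
Qed.

(** In Z/3 both sides have the same image [c z - c x]; as integers they are in
{-2, 0, 2}, on which reduction modulo 3 is injective. *)
Lemma weight_flat (x y z t : G) :
  adj x y -> adj y z -> adj x t -> adj t z ->
  weight x y + weight y z = weight x t + weight t z.
Proof.
move=> /colour_neq + /colour_neq + /colour_neq + /colour_neq; rewrite /weight; move: (c x) (c y) (c z) (c t).
by (do 4!case=> [[|[|[|//]]] ?]) => //= _ _ _ _; rewrite ?subrr ?addNr.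
Qed.

End Weight.

(** Since [a = p - q] has the parity of the odd number [p + q], [a * M] and
[M] differ by a multiple of [2M]. *)
Lemma mulrn_odd_half (R : pzRingType) (a : R) M p q :
  M.*2%:R = 0 :> R -> odd (p + q) -> a + q%:R = p%:R -> a *+ M = M%:R.
Proof.
move=> MR2 odd_pq def_a.
have def_pq : (p + q)%:R = a + q.*2%:R by rewrite -addnn !natrD -def_a addrA.
have kM k : k.*2%:R *+ M = 0 :> R.
  by rewrite -mulrnA -doubleMl doubleMr natrM MR2 mulr0.
have -> : a *+ M = (p + q)%:R *+ M by rewrite def_pq mulrnDl kM addr0.
by rewrite -(odd_double_half (p + q)) odd_pq natrD mulrnDl kM addr0.
Qed.

Lemma three_coloured_no_odd_closed_walk (G : sgraph) (c : G -> 'Z_3) n (x : G) :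
  zero_two_graph G -> proper_colouring c -> walk n x x -> ~~ odd n.
Proof.
move=> G02 c_proper wn; apply/negP=> oddn.
pose M := #|G|.+1; pose R := 'Z_(M.*2).
have gt1M : (1 < M.*2)%N by rewrite /M; lia.
pose H := cover (weight_anti R c_proper).
(* The weight of a walk is the number [p] of its steps of weight 1 minus the
   number [q] of its steps of weight -1. *)
have height m (u v : H) : walk m u v ->
    exists p q, (p + q = m)%N /\ v.2 + q%:R = u.2 + p%:R.
  elim: m v => [|m IHm] v; first by move/eqP <-; exists 0, 0.
  case/walkSE=> w /IHm[p [q [<- def_w]]] /andP[_ /eqP->].
  rewrite /weight; case: ifP => _.
    exists p.+1, q; rewrite addSn; split=> //.
    by rewrite addrAC def_w -addrA natr1.
  exists p, q.+1; rewrite addnS; split=> //.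
  by rewrite -natr1 addrACA addNr addr0.
have MR2 : M.*2%:R = 0 :> R by rewrite pchar_Zp.
have [a wa] := cover_lift (weight_anti R c_proper) 0 wn.
have aM : a *+ M = M%:R.
  have [p [q [def_n]]] := height _ _ _ wa; rewrite /= add0r => def_a.
  by apply: mulrn_odd_half MR2 _ def_a; rewrite def_n.
have := cover_repeat M wa; rewrite aM.
have H02 : zero_two_graph H by apply: cover_zero_two G02; apply: weight_flat.
case/(zero_two_short_walk H02 (@cover_degree _ _ _ _)) => m le_m.
case/height=> p [q [def_m]]; rewrite /= add0r -natrD => /(congr1 val) /=.
(* Here p = M + q modulo 2M although p + q < M: both sides are below 2M, so
   they are equal, which is impossible. *)
by rewrite !val_Zp_nat // !modn_small /M; lia.
Qed.

Local Close Scope ring_scope.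

Lemma three_coloured_bipartite (G : sgraph) :
  zero_two_graph G -> three_colourable G -> bipartite G.
Proof.
move=> G02 [c c_proper]; apply: bipartite_no_odd_closed_walk => n x.
exact: three_coloured_no_odd_closed_walk c_proper.
Qed.

Lemma bipartite_colourable2 (G : sgraph) : bipartite G -> colourable G 2.
Proof.
case=> A bipA; apply/existsP; exists [ffun x => inord (x \in A)].
apply/forallP=> x; apply/forallP=> y; apply/implyP=> /bipA; rewrite !ffunE.
by apply: contra => /eqP/(congr1 val); rewrite /= !inordK; do 2!case: (_ \in A).
Qed.

Theorem theorem2 :
  (forall G : sgraph, zero_two_graph G -> three_colourable G -> bipartite G) /\
  (forall G : sgraph, zero_two_graph G -> chromatic_number G <> 3).
Proof.
split=> [|G G02]; first exact: three_coloured_bipartite.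
rewrite /chromatic_number; case: ex_minnP => m col_m min_m m3.
move: col_m min_m; rewrite m3 => /existsP[c c_proper] min3.
have G3 : three_colourable G by exists c.
by have := min3 2 (bipartite_colourable2 (three_coloured_bipartite G02 G3)).
Qed.
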